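(* Let $N\geq 2$ be an integer and for each $n\geq 0$ let $S_n\subseteq\{0,1,\dots,N-1\}^n$. If \[ \limsup_{n\to\infty}\frac{\log_N(|S_n|)}{n}=1, \] then $\limsup_{n\to\infty} M(S_n)=\infty$. Moreover, this is optimal in the following sense: for every $\epsilon>0$ there is a family of subsets $S_n\subseteq\{0,1,\dots,N-1\}^n$ such that $\{M(S_n)\}_n$ is uniformly bounded and $\frac{\log_N(|S_n|)}{n}>1-\epsilon$ for every $n$.
   Context: For a finite set $S\subseteq\mathbb{Z}^n$, $M(S):=M(\mathrm{Conv}(S))$, where $\mathrm{Conv}(S)\subseteq\mathbb{R}^n$ is the convex hull and, for an integral convex polytope $P\subseteq\mathbb{R}^n$, $M(P)$ is the largest integer $m$ such that there is a unimodular affine transformation $A$ (an affine map $x\mapsto Bx+z$ with $B$ an injective integer $n\times m$ matrix and $z\in\mathbb{Z}^n$) with $A([0,1]^m)\subseteq P$. *)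

(* Defs.v *)
From mathcomp Require Import all_boot all_order all_algebra finmap.
From mathcomp Require Import all_classical all_reals all_analysis.

Set Implicit Arguments.
Unset Strict Implicit.
Unset Printing Implicit Defensive.
Import Order.TTheory GRing.Theory Num.Theory.

Local Open Scope classical_set_scope.
Local Open Scope ring_scope.

Definition unit_cube (R : realType) (m : nat) : set 'cV[R]_m :=
  [set x : 'cV[R]_m | forall i, 0 <= x i 0 <= 1].
Arguments unit_cube : clear implicits.

Definition int_affine (R : realType) (n m : nat)
    (B : 'M[int]_(n, m)) (z : 'cV[int]_n) (x : 'cV[R]_m) : 'cV[R]_n :=
  map_mx intr B *m x + map_mx intr z.

Definition contains_cube (R : realType) (n : nat) (P : set 'cV[R]_n)
    (m : nat) : Prop :=
  exists (B : 'M[int]_(n, m)) (z : 'cV[int]_n),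
    injective (fun x : 'cV[R]_m => map_mx intr B *m x) /\
    int_affine B z @` unit_cube R m `<=` P.

(* An injective n x m matrix has m <= n, so it is enough to look for the
   largest m among 0, ..., n; [contains_cube_maxcube] and [maxcube_largest]
   below say that this is the largest m overall. If P contains no integer
   point (for P = Conv S: if S is empty), no m exists and the value is 0. *)
Definition maxcube (R : realType) (n : nat) (P : set 'cV[R]_n) : nat :=
  \max_(m < n.+1 | `[< contains_cube P m >]) m.

Definition Conv (R : realType) (n : nat) (S : {fset 'cV[int]_n}) :
    set 'cV[R]_n :=
  smallest (@convex_set R 'cV[R]_n) (map_mx intr @` [set` S]).
Arguments Conv R {n} S.

Definition M (R : realType) (n : nat) (S : {fset 'cV[int]_n}) : nat :=
  maxcube (Conv R S).

Definition box (N n : nat) : set 'cV[int]_n :=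
  [set x : 'cV[int]_n | forall i, 0 <= x i 0 < N%:Z].
Arguments box : clear implicits.

(* Extended-real valued, with log_N 0 = -oo, since S may be empty. *)
Definition log_card (R : realType) (N n : nat) (S : {fset 'cV[int]_n}) :
    \bar R :=
  (lne (#|` S|%:R)%:E / (ln N%:R)%:E)%E.

Lemma contains_cube_dim (R : realType) (n : nat) (P : set 'cV[R]_n) (m : nat) :
  contains_cube P m -> (m <= n)%N.
Proof.
move=> [B [z [inj _]]]; set C := map_mx intr B in inj.
have free : row_free (C : 'M[R]_(n, m))^T.
  rewrite -kermx_eq0; apply/eqP/row_matrixP => i; rewrite row0.
  apply: trmx_inj; apply: inj; apply: trmx_inj.
  by rewrite trmx_mul trmxK -row_mul mulmx_ker row0 trmx0 mulmx0 trmx0.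
by move/eqP: free => <-; exact: rank_leq_col.
Qed.

Lemma maxcube_largest (R : realType) (n : nat) (P : set 'cV[R]_n) (m : nat) :
  contains_cube P m -> (m <= maxcube P)%N.
Proof.
move=> Pm; have mn : (m < n.+1)%N by rewrite ltnS (contains_cube_dim Pm).
exact: (@leq_bigmax_cond _ (fun i : 'I_n.+1 => `[< contains_cube P i >])
  (fun i => nat_of_ord i) (Ordinal mn) (asboolT Pm)).
Qed.

Lemma contains_cube_maxcube (R : realType) (n : nat) (P : set 'cV[R]_n)
    (z : 'cV[int]_n) :
  P (map_mx intr z) -> contains_cube P (maxcube P).
Proof.
move=> Pz; have P0 : contains_cube P 0.
  exists 0, z; split; first by move=> x y _; rewrite [x]flatmx0 [y]flatmx0.
  by move=> _ [x _ <-]; rewrite /int_affine [x]flatmx0 mulmx0 add0r.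
pose A := [pred i : 'I_n.+1 | `[< contains_cube P i >]].
have A0 : (0 < #|A|)%N by apply/card_gt0P; exists ord0; exact/asboolP.
have [i /asboolP Pi maxE] := eq_bigmax_cond (fun i => nat_of_ord i) A0.
by rewrite /maxcube (_ : \max_(_ < _ | _) _ = i).
Qed.

(* Main.v *)
Require Import Defs.
From mathcomp Require Import all_boot all_order all_algebra finmap.
From mathcomp Require Import all_classical all_reals all_analysis.
From mathcomp Require Import zify ring lra.
Import Order.TTheory GRing.Theory Num.Theory.
Local Open Scope classical_set_scope.
Local Open Scope ring_scope.

(* Growth: a pigeonhole argument on blocks of coordinates shows that a subset
   of {0, ..., N-1}^n without an m-dimensional cube among its own points has at
   most m N^(n - k) elements as soon as 4^m k <= n. If M(S_n) < m for all large
   n, this makes limsup log_N |S_n| / n at most 1 - 1 / (2 * 4^m).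

   Optimality: S_n is the largest fibre on the box of one linear functional a
   with nonnegative integer coefficients. A cube in Conv(S_n) has directions in
   the kernel of a, and since it stays inside the box, when its dimension is
   at least m one of them has at most N n / m nonzero entries. There are few
   such sparse vectors, so a can be chosen with no nonzero sparse vector in its
   kernel and with coefficients at most their number X; then the functional
   takes at most n N X + 1 values on the box. *)

(** * Cubes in convex sets *)

Lemma convex_comb (R : realType) (n : nat) (P : set 'cV[R]_n) (x y : 'cV[R]_n)
    (t : R) :
  @convex_set R 'cV[R]_n P -> P x -> P y -> 0 <= t <= 1 ->
  P (t *: x + (1 - t) *: y).
Proof.
move=> cP Px Py /andP[t0 t1].
by have /set_mem := cP x y (Itv01 t0 t1) (mem_set Px) (mem_set Py).
Qed.

(** Induction on the number [k] of leading coordinates not yet known to be 0 or 1: a point of the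
    cube lies on the segment between the two points obtained by resetting one such coordinate to 1
    and to 0. *)
Lemma convex_cube (R : realType) (n m : nat) (P : set 'cV[R]_n)
    (B : 'M[R]_(n, m)) (z : 'cV[R]_n) :
  @convex_set R 'cV[R]_n P ->
  (forall b : 'I_m -> bool, P (B *m (\col_j (b j)%:R) + z)) ->
  forall x, unit_cube R m x -> P (B *m x + z).
Proof.
move=> cP Pb.
suff H k (x : 'cV[R]_m) : unit_cube R m x ->
    (forall i : 'I_m, (k <= i)%N -> x i 0 = 0 \/ x i 0 = 1) -> P (B *m x + z).
  by move=> x x01; apply: (H m) => // i; rewrite leqNgt ltn_ord.
elim: k x => [|k IHk] x x01 xk.
  rewrite (_ : x = \col_j (x j 0 == 1)%:R); first exact: Pb.
  apply/colP => j; rewrite mxE.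
  by have [->|->] := xk j (leq0n _); rewrite ?eqxx // eq_sym oner_eq0.
have [mk|km] := leqP m k.
  by apply: IHk => // i ki; have := ltn_ord i; rewrite ltnNge (leq_trans mk).
pose i := Ordinal km; pose X s : 'cV[R]_m := \col_j if j == i then s else x j 0.
have PX s : s = 0 \/ s = 1 -> P (B *m X s + z).
  move=> s01; apply: IHk => j; rewrite mxE.
    by case: ifP => // _; case: s01 => ->; rewrite ?lexx ?ler01.
  case: eqVneq => // ji kj; apply: xk; rewrite ltn_neqAle kj andbT.
  by apply: contra ji => /eqP kj'; apply/eqP/val_inj.
have -> : B *m x + z =
    x i 0 *: (B *m X 1 + z) + (1 - x i 0) *: (B *m X 0 + z).
  rewrite !scalerDr addrACA -scalerDl subrKC scale1r; congr (_ + _).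
  rewrite !scalemxAr -mulmxDr; congr (_ *m _); apply/colP => j; rewrite !mxE.
  by case: eqP => [->|_]; rewrite ?mulr1 ?mulr0 ?addr0 // -mulrDl subrKC mul1r.
by apply: convex_comb => //; apply: PX; [right|left].
Qed.

(** * Discrete cubes and the pigeonhole bound *)

(** Coordinates in ['I_N] make the box a finite type, so that its subsets can be counted. *)
Definition grid {N n : nat} (x : 'cV['I_N]_n) : 'cV[int]_n :=
  map_mx (fun i : 'I_N => (i : nat)%:Z) x.

Lemma grid_inj (N n : nat) : injective (@grid N n).
Proof.
move=> x y /colP xy; apply/colP => i; have := xy i.
by rewrite !mxE => -[/val_inj].
Qed.

(** Only the vertices are required to lie in [S], which makes the notion combinatorial; convexity
    fills in the rest of the cube. The kernel condition is over [R] to match [contains_cube]. *)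
Definition discrete_cube (R : realType) {N n : nat} (S : {set 'cV['I_N]_n})
    (m : nat) : Prop :=
  exists (B : 'M[int]_(n, m)) (z : 'cV[int]_n),
    (forall x : 'cV[R]_m, map_mx intr B *m x = 0 -> x = 0) /\
    forall b : 'I_m -> bool,
      exists2 s, s \in S & B *m (\col_j (b j)%:Z) + z = grid s.

Lemma contains_cube_Conv (R : realType) (N n m : nat) (S : {set 'cV['I_N]_n})
    (T : {fset 'cV[int]_n}) :
  (forall s, s \in S -> grid s \in T) -> discrete_cube R S m ->
  contains_cube (Conv R T) m.
Proof.
move=> ST [B [z [B0 Bz]]]; exists B, z; split.
  move=> x y /= /eqP; rewrite -subr_eq0 -mulmxBr => /eqP /B0 /eqP.
  by rewrite subr_eq0 => /eqP.
move=> _ [x x01 <-]; rewrite /int_affine => P [cP TP].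
apply: convex_cube => // b; have [s sS E] := Bz b.
apply: TP; exists (grid s); first exact: ST.
rewrite -E map_mxD map_mxM; congr (_ *m _ + _).
by apply/colP => j; rewrite !mxE.
Qed.

Lemma discrete_cubeS (R : realType) (N k n m : nat)
    (S : {set 'cV['I_N]_(k + n)}) (x x' : 'cV['I_N]_k) :
  x != x' ->
  discrete_cube R [set y | (col_mx x y \in S) && (col_mx x' y \in S)]%SET m ->
  discrete_cube R S (1 + m).
Proof.
move=> xx' [B [z [B0 Bz]]].
(* The new direction lives in the first [k] coordinates and the old ones in the last [n], so
   injectivity can be checked blockwise. *)
exists (block_mx (grid x' - grid x) 0 0 B : 'M[int]_(k + n, 1 + m)).
exists (col_mx (grid x) z); split.
  move=> t; rewrite -[t](@vsubmxK _ 1 m 1) map_block_mx !map_mx0.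
  rewrite (@mul_block_col _ k n 1 m 1) !mul0mx addr0 add0r.
  rewrite -[X in _ = X -> _]col_mx0 => /eq_col_mx[tx /B0 ->].
  have [i xi] : exists i, grid x' i 0 - grid x i 0 != 0.
    apply/existsP; apply: contraNT xx'; rewrite negb_exists => /forallP xi.
    apply/eqP/grid_inj/colP => i; apply/eqP; rewrite eq_sym -subr_eq0.
    by rewrite -[_ == _]negbK.
  rewrite -[RHS]col_mx0; congr col_mx.
  apply/colP => j; rewrite (ord1 j) [RHS]mxE; move/colP: tx => /(_ i).
  rewrite [LHS]mxE big_ord1 !mxE => /eqP; rewrite mulf_eq0 => /orP[|/eqP //].
  by rewrite intr_eq0; move: xi; rewrite !mxE => /negPf ->.
move=> b; have [s] := Bz (b \o lift ord0); rewrite inE => /andP[sx sx'] E.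
exists (col_mx (if b ord0 then x' else x) s); first by case: ifP.
rewrite [in RHS]/grid map_col_mx -/(grid s) -E.
rewrite (_ : \col_j _ = col_mx (b ord0)%:Z%:M (\col_j (b (lift ord0 j))%:Z)
    :> 'cV[int]_(1 + m)); last first.
  apply/colP => j; rewrite -[j in RHS]splitK mxE.
  case: splitP => [j0 jE|j1 jE] /=.
    rewrite (@col_mxEu _ 1 m 1) (ord1 j0) mxE eqxx mulr1n.
    congr (Posz (nat_of_bool (b _))).
    by apply: val_inj; rewrite /= jE (ord1 j0).
  rewrite (@col_mxEd _ 1 m 1) mxE; congr (Posz (nat_of_bool (b _))).
  exact: val_inj.
rewrite (@mul_block_col _ k n 1 m 1) !mul0mx addr0 add0r (@add_col_mx _ k n 1).
rewrite mul_mx_scalar; congr col_mx.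
by case: (b ord0); rewrite ?scale1r ?subrK // scale0r add0r.
Qed.

(* Split [n = k + n'], fibre [S] over the last [n'] coordinates, and fix two
   distinct first parts [x], [x']: a cube in the set of [y] with [(x, y)] and
   [(x', y)] both in [S] gains the direction [x' - x] in [S]. *)
Lemma cube_free_card (R : realType) (N m k n : nat) (S : {set 'cV['I_N]_n}) :
  (4 ^ m * k <= n)%N -> ~ discrete_cube R S m -> (#|S| <= m * N ^ (n - k))%N.
Proof.
elim: m k n S => [|m IHm] k n S kn nS.
  (* A single point is already a 0-dimensional cube, so [S] must be empty. *)
  rewrite mul0n leqn0; apply/eqP/eq_card0 => s; apply/negP => sS; apply: nS.
  exists 0, (grid s); split => [x _|b]; first by rewrite [x]flatmx0.
  by exists s; rewrite // mul0mx add0r.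
have p4 : (0 < 4 ^ m)%N by rewrite expn_gt0.
have k4 : (k <= 4 ^ m * k)%N by rewrite leq_pmull.
(* The induction hypothesis is used with [3 * k] in place of [k]: the saving [N ^ (3 * k)] pays for
   the [N ^ (2 * k)] pairs of first parts and the factor [N ^ k] in [cardF]. Hence the base 4 = 1 +
   3. *)
have kn' : (4 ^ m * (3 * k) <= n - k)%N.
  by move: kn; rewrite expnS mulnAC -mulnA; lia.
have {kn k4} leqkn : (k <= n)%N by move: kn; rewrite expnS -mulnA; lia.
have [n' nE] : exists n', n = (k + n')%N by exists (n - k)%N; rewrite subnKC.
move: S nS kn'; rewrite nE addKn {leqkn nE} => {n}; move: n' => n S nS kn.
pose F (y : 'cV['I_N]_n) := [set x : 'cV_k | col_mx x y \in S]%SET.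
pose G (p : 'cV['I_N]_k * 'cV['I_N]_k) :=
  [set y : 'cV_n | (col_mx p.1 y \in S) && (col_mx p.2 y \in S)]%SET.
have cardS : #|S| = (\sum_y #|F y|)%N.
  rewrite -sum1_card; under [RHS]eq_bigr do rewrite -sum1_card.
  rewrite pair_big_dep
    (reindex (fun p : 'cV['I_N]_n * 'cV['I_N]_k => col_mx p.2 p.1)) /=.
    by apply: eq_bigl => -[y x]; rewrite inE.
  exists (fun s => (dsubmx s, usubmx s)) => [[y x] _|s _] /=.
    by rewrite col_mxKu col_mxKd.
  exact: vsubmxK.
(* A fibre with two distinct elements puts [y] in some [G p], and then the trivial bound [N ^ k] on
   the fibre suffices. *)
have cardF y : (#|F y| <= 1 + N ^ k * \sum_(p | p.1 != p.2) (y \in G p))%N.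
  have [|/card_gt1P[x [x' [xF x'F xx']]]] := leqP #|F y| 1.
    by move=> /leq_trans; apply; rewrite leq_addr.
  rewrite (bigD1 (x, x')) //= inE; rewrite !inE in xF x'F; rewrite xF x'F.
  apply: leq_trans (max_card _) _; rewrite card_mx card_ord muln1 mulnDr.
  by rewrite muln1; lia.
have cardG p : p.1 != p.2 -> (#|G p| <= m * N ^ (n - 3 * k))%N.
  by move=> pp; apply: IHm => // cG; apply: nS; apply: discrete_cubeS cG.
have le3 : (3 * k <= n)%N by apply: leq_trans kn; rewrite leq_pmull.
rewrite cardS; apply: leq_trans; first by apply: leq_sum => y _; exact: cardF.
rewrite big_split /= sum1_card card_mx card_ord muln1 mulSn leq_add2l.
rewrite -big_distrr /= exchange_big /=.
have -> : (m * N ^ n =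
    N ^ k * (N ^ (k * 1) * N ^ (k * 1) * (m * N ^ (n - 3 * k))))%N.
  have -> : (N ^ n = N ^ k * N ^ k * N ^ k * N ^ (n - 3 * k))%N.
    by rewrite -!expnD; congr (N ^ _)%N; lia.
  by rewrite muln1; move: (N ^ k)%N (N ^ _)%N => a b; ring.
rewrite leq_mul2l; apply/orP; right.
apply: leq_trans (_ : \sum_(p | p.1 != p.2) m * N ^ (n - 3 * k) <= _)%N.
  by apply: leq_sum => p pp; rewrite -big_mkcond /= sum1_card cardG.
rewrite sum_nat_const leq_mul2r; apply/orP; right.
by apply: leq_trans (max_card _) _; rewrite card_prod !card_mx card_ord.
Qed.

(** * From cardinalities to the limsup *)

Lemma grid_box (N n : nat) (s : 'cV['I_N]_n) : box N n (grid s).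
Proof. by move=> i; rewrite mxE /= ltz_nat ltn_ord. Qed.

Lemma box_grid (N n : nat) (x : 'cV[int]_n) :
  box N n x -> exists s : 'cV['I_N]_n, grid s = x.
Proof.
move=> xN; have xN' i : (absz (x i 0%R) < N)%N by have := xN i; rewrite /=; lia.
exists (\col_i Ordinal (xN' i)); apply/colP => i; rewrite !mxE /=.
by have := xN i; lia.
Qed.

Lemma leq_card_grid (N n : nat) (T : {fset 'cV[int]_n}) :
  [set` T] `<=` box N n ->
  (#|` T| <= #|[set s : 'cV['I_N]_n | grid s \in T]%SET|)%N.
Proof.
move=> TN; set S := finset.finset _.
apply: leq_trans (_ : (#|` [fset grid s | s in S]%fset| <= _)%N).
  apply/fsubset_leq_card/fsubsetP => x xT.
  have [s sx] := box_grid _ _ _ (TN x xT).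
  by apply/imfsetP; exists s; rewrite //= inE sx.
by rewrite cardE (leq_trans (leq_imfset_card _ _ _)).
Qed.

Lemma ln_nat_gt0 (R : realType) (N : nat) : (2 <= N)%N -> 0 < ln N%:R :> R.
Proof. by move=> N2; apply: ln_gt0; rewrite ltr1n. Qed.

Lemma ediv_fin (R : realType) (x y : R) :
  y != 0 -> (x%:E / y%:E)%E = (x / y)%:E.
Proof. by move=> y0; rewrite inver (negPf y0) EFinM. Qed.

Lemma log_cardE (R : realType) (N n : nat) (T : {fset 'cV[int]_n}) :
  (2 <= N)%N -> (0 < #|` T|)%N -> (0 < n)%N ->
  (log_card R N T / n%:R%:E)%E = (ln (#|` T|)%:R / ln N%:R / n%:R)%:E.
Proof.
move=> N2 T0 n0; rewrite /log_card lne_EFin ?ltr0n // !ediv_fin //.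
  by rewrite pnatr_eq0 -lt0n.
by rewrite gt_eqF // ln_nat_gt0.
Qed.

Lemma log_card_small (R : realType) (N m n : nat) (T : {fset 'cV[int]_n}) :
  (2 <= N)%N -> [set` T] `<=` box N n -> (M R T < m)%N ->
  (2 * 4 ^ m * m.+1 <= n)%N ->
  (log_card R N T / n%:R%:E <= (1 - (2 * 4 ^ m)%:R^-1)%:E)%E.
Proof.
move=> N2 TN Mm mn; have q0 : (0 < 4 ^ m)%N by rewrite expn_gt0.
have n0 : (0 < n)%N by apply: leq_trans mn; rewrite !muln_gt0 q0.
(* The empty set has logarithm -oo, which division by positive reals preserves. *)
have [T0|T0] := posnP #|` T|.
  rewrite /log_card T0 le0_lneNy // !inver !gt_eqF ?ln_nat_gt0 ?ltr0n //.
  by rewrite gt0_mulNye ?gt0_mulNye ?leNye //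
    lte_fin invr_gt0 ?ln_nat_gt0 ?ltr0n.
rewrite log_cardE // lee_fin ler_pdivrMr ?ltr0n // ler_pdivrMr ?ln_nat_gt0 //.
(* The factor [m] is absorbed in [N ^ m]. Rounding in the quotient costs less than 1, so the
   exponent is below [n - n / 4 ^ m + (m + 1)]; the lower bound on [n] makes [m + 1] at most half of
   [n / 4 ^ m]. *)
have cardT : (#|` T| <= N ^ (m + (n - n %/ 4 ^ m)))%N.
  apply: leq_trans (leq_card_grid N n T TN) _.
  apply: leq_trans (cube_free_card R N m (n %/ 4 ^ m) n _ _ _) _.
  - by rewrite mulnC leq_trunc_div.
  - move=> cS; have cT : contains_cube (Conv R T) m.
      by apply: contains_cube_Conv cS => s; rewrite inE.
    by have := maxcube_largest cT; rewrite leqNgt => /negP; apply.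
  - by rewrite expnD leq_mul2r ltnW ?orbT // ltn_expl.
apply: le_trans (_ : ln ((N ^ (m + (n - n %/ 4 ^ m)))%:R) <= _).
  by rewrite ler_ln ?posrE ?ltr0n ?expn_gt0 ?(ltnW N2) // ler_nat.
rewrite natrX lnXn ?ltr0n ?(ltnW N2) // -[_ *+ (_ + _)]mulr_natl.
rewrite ler_wpM2r //; first by rewrite ltW ?ln_nat_gt0.
have q2 : 0 < (2 * 4 ^ m)%:R :> R by rewrite ltr0n muln_gt0.
rewrite -(ler_pM2r q2) mulrAC mulrBl mul1r mulVf ?gt_eqF //.
rewrite -[1]/(1%:R) -natrB; last first.
  by rewrite muln_gt0.
rewrite -!natrM ler_nat; have := divn_eq n (4 ^ m); have := ltn_pmod n q0.
have := leq_div n (4 ^ m).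
move: q0 mn; move: (n %/ 4 ^ m)%N => u; move: (n %% 4 ^ m)%N => r.
by move: (4 ^ m)%N => q; nia.
Qed.

Lemma limn_esup_inf (R : realType) (u : nat -> \bar R) :
  limn_esup u = ereal_inf (range (esups u)).
Proof. by rewrite limn_esup_lim; apply/cvg_lim => //; exact: cvg_esups_inf. Qed.

Lemma limsup_M_infty (R : realType) (N : nat)
    (S : forall n, {fset 'cV[int]_n}) :
  (2 <= N)%N -> (forall n, [set` S n] `<=` box N n) ->
  limn_esup (fun n => log_card R N (S n) / n%:R%:E)%E = 1%E ->
  limn_esup (fun n => (M R (S n))%:R%:E : \bar R) = +oo%E.
Proof.
move=> N2 SN lim1; apply/eqyP => A A0.
pose m := Num.truncn A; rewrite limn_esup_inf.
apply: le_ereal_inf_tmp => _ [n0 _ <-].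
have [n n0n mM] : exists2 n, (n0 <= n)%N & (m.+1 <= M R (S n))%N.
  apply: contrapT => noM; suff : (1 <= (1 - (2 * 4 ^ m.+1)%:R^-1 : R)%:E)%E.
    by rewrite lee_fin lerDl oppr_ge0 invr_le0 leNgt ltr0n muln_gt0 expn_gt0.
  rewrite -lim1 limn_esup_inf; apply: ge_ereal_inf.
  exists (esups (fun n => log_card R N (S n) / n%:R%:E)%E
    (maxn n0 (2 * 4 ^ m.+1 * m.+2))).
  by exists (maxn n0 (2 * 4 ^ m.+1 * m.+2)).
  apply: ge_ereal_sup => _ [n + <-]; rewrite /= geq_max => /andP[n0n mn].
  apply: log_card_small => //; rewrite ltnNge; apply/negP => mM.
  by apply: noM; exists n.
apply: le_trans (_ : (M R (S n))%:R%:E <= _)%E; last first.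
  by apply: ereal_sup_ubound; exists n.
rewrite lee_fin; apply: ltW; apply: lt_le_trans (_ : m.+1%:R <= _).
  exact: Num.Theory.truncnS_gt.
by rewrite ler_nat.
Qed.

(** * Functionals without sparse vectors in their kernel *)

(* Induction on the dimension: once the other coordinates of [a] are fixed,
   each vector excludes at most one value of the first coordinate, so one of
   the [#|I| + 1] available values remains. *)
Lemma generic_functional (I : finType) (n : nat) (v : I -> 'I_n -> int) :
  exists a : 'I_n -> nat, (forall i, a i <= #|I|)%N /\
    forall k, (exists i, v k i != 0) -> \sum_i (a i)%:Z * v k i != 0.
Proof.
elim: n v => [|n IHn] v; first by exists (fun=> 0%N); split => // k [[]].
have [a [aI av]] := IHn (fun k i => v k (lift ord0 i)).
pose w k := \sum_i (a i)%:Z * v k (lift ord0 i).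
(* If [v k ord0] is 0, the quotient is the default 0; this value is excluded needlessly, and the
   induction hypothesis handles [k]. Taking [absz] is harmless because only natural numbers are
   candidates. *)
pose bad k := absz (- w k %/ v k ord0)%Z.
have [t tI tbad] : exists2 t, (t <= #|I|)%N & forall k, bad k != t.
  apply: contrapT => notb.
  have : (size (iota 0 #|I|.+1) <= size (map bad (enum I)))%N.
    apply: uniq_leq_size; first exact: iota_uniq.
    move=> t; rewrite mem_iota add0n => tI; apply: contrapT => tn; apply: notb.
    exists t => // k; apply: contraPneq tn => <-; apply.
    by apply: map_f; rewrite mem_enum.
  by rewrite size_map size_iota -cardE ltnn.
exists (fun i => if unlift ord0 i is Some j then a j else t); split.
  by move=> i; case: unliftP.
move=> k [i vki]; rewrite big_ord_recl unlift_none.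
under eq_bigr do rewrite liftK.
rewrite -/(w k); have [vk0|vk0] := eqVneq (v k ord0) 0.
  rewrite vk0 mulr0 add0r; apply: av; case: (unliftP ord0 i) vki => [j|] ->.
    by exists j.
  by rewrite vk0.
apply: contra (tbad k); rewrite addr_eq0 => /eqP tv.
by rewrite /bad -tv mulzK.
Qed.

(** Expand a product over the coordinates, each factor giving weight [T] to [j0] and 1 to every
    other element. *)
Lemma sum_zeros (J : finType) (j0 : J) (n T : nat) :
  (\sum_(f : {ffun 'I_n -> J}) T ^ #|[pred i | f i == j0]| =
   (T + #|J|.-1) ^ n)%N.
Proof.
transitivity (\prod_(i < n) \sum_(j : J) (if j == j0 then T else 1))%N.
  rewrite bigA_distr_bigA; apply: eq_bigr => f _.
  by rewrite -big_mkcond prod_nat_const.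
transitivity (\prod_(i < n) (T + #|J|.-1))%N; last first.
  by rewrite prod_nat_const card_ord.
apply: eq_bigr => i _.
rewrite (bigD1 j0) //= eqxx; congr addn.
rewrite (eq_bigr (fun=> 1%N)) => [|j /negPf -> //].
by rewrite sum1_card cardC1.
Qed.

Definition sparse {J : finType} (j0 : J) {n : nat} (m L : nat)
    (f : {ffun 'I_n -> J}) : bool :=
  (m * #|[pred i | f i != j0]| <= L * n)%N.

(** A Chernoff-type count. Each of the two inequalities on [T] costs one factor [c ^ n]: the first
    bounds the weight lost at the nonzero entries of a sparse [f], the second the total weight. *)
Lemma card_sparse (R : realType) (J : finType) (j0 : J) (n m L T : nat)
    (c : R) :
  1 <= c -> (0 < T)%N -> (0 < m)%N -> T%:R ^+ L <= c ^+ m ->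
  (T + #|J|.-1)%:R <= c * T%:R ->
  (#|[pred f : {ffun 'I_n -> J} | sparse j0 m L f]|)%:R <= c ^+ (2 * n).
Proof.
move=> c1 T0 m0 TL TJ.
have T0' : 0 < T%:R ^+ n :> R by rewrite exprn_gt0 ?ltr0n.
have c0 : 0 <= c by apply: le_trans c1.
rewrite -(ler_pM2r T0').
(* A sparse [f] has [T ^ #nonzeros <= c ^ n], hence
   [T ^ n <= c ^ n * T ^ #zeros]; now sum over all [f]. *)
apply: le_trans (_ : c ^+ n * (\sum_(f : {ffun 'I_n -> J})
    T ^ #|[pred i | f i == j0]|)%:R <= _).
  rewrite natr_sum -sum1_card natr_sum mulr_suml mulr_sumr.
  rewrite big_mkcond; apply: ler_sum => f _; rewrite inE.
  case: ifP => [sf|_]; last by rewrite mulr_ge0 ?exprn_ge0 ?ler0n.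
  have : (#|[pred i | f i == j0]| + #|[pred i | f i != j0]| = n)%N.
    by rewrite -[RHS](card_ord n) -(cardC [pred i | f i == j0]).
  move: sf; rewrite /sparse; move: #|_| #|_| => s u ms us.
  have -> : T%:R ^+ n = T%:R ^+ u * (T ^ s)%:R :> R.
    by rewrite -us addnC exprD natrX.
  rewrite mul1r ler_wpM2r ?ler0n //.
  rewrite -(ler_pXn2r m0) ?nnegrE ?exprn_ge0 ?ler0n // -!exprM.
  apply: le_trans (_ : T%:R ^+ (L * n) <= _).
    by rewrite ler_weXn2l ?ler1n // mulnC.
  by rewrite [(n * m)%N]mulnC !exprM lerXn2r ?nnegrE ?exprn_ge0 ?ler0n.
rewrite sum_zeros natrX mul2n -addnn exprD -mulrA ler_wpM2l ?exprn_ge0 //.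
by rewrite -exprMn lerXn2r ?nnegrE ?ler0n ?mulr_ge0.
Qed.

Lemma large_fibre (N n X : nat) (a : 'I_n -> nat) :
  (0 < N)%N -> (forall i, a i <= X)%N ->
  exists c : nat,
    (N ^ n <= #|[set s : 'cV['I_N]_n | \sum_i a i * s i ord0 == c]%SET| *
      (n * N * X).+1)%N.
Proof.
move=> N0 aX; pose phi (s : 'cV['I_N]_n) := (\sum_i a i * s i ord0)%N.
have phiW s : (phi s < (n * N * X).+1)%N.
  rewrite ltnS /phi -mulnA -[n in (n * _)%N]card_ord -sum_nat_const.
  apply: leq_sum => i _; rewrite mulnC; apply: leq_mul; last exact: aX.
  exact: ltnW.
have cardF : (N ^ n =
    \sum_(c < (n * N * X).+1) #|[set s : 'cV['I_N]_n | phi s == c]%SET|)%N.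
  transitivity #|[set: 'cV['I_N]_n]%SET|.
    by rewrite cardsT card_mx card_ord muln1.
  rewrite -sum1_card (partition_big (fun s => Ordinal (phiW s)) xpredT) //=.
  apply: eq_bigr => c _; rewrite -sum1_card; apply: eq_bigl => s.
  by rewrite !inE.
apply: contrapT => noc.
have : ((n * N * X).+1 * N ^ n <= \sum_(c < (n * N * X).+1) (N ^ n).-1)%N.
  rewrite {1}cardF big_distrr /=; apply: leq_sum => c _.
  rewrite -ltnS prednK ?expn_gt0 ?N0 // mulnC ltnNge; apply/negP => Nc.
  by apply: noc; exists c.
by rewrite sum_nat_const card_ord leq_mul2l /= leqNgt ltn_predL expn_gt0 N0.
Qed.

(** * Dimension of cubes in a fibre *)

Lemma convex_setI (R : realType) (n : nat) (P : set 'cV[R]_n) :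
  (forall x y t, 0 <= t <= 1 -> P x -> P y -> P (t *: x + (1 - t) *: y)) ->
  @convex_set R 'cV[R]_n P.
Proof.
move=> cP x y t /set_mem Px /set_mem Py; apply/mem_set.
by apply: (cP x y t%:num) => //; rewrite ge0 le1.
Qed.

(* The convex hull stays in the box and in the hyperplane [a . y = c]. So the
   columns of [B] are in the kernel of [a], while the box forces each row of
   [B] to have l1-norm less than [N], so that some column is sparse. *)
Lemma cube_dim_bound (R : realType) (N n m j c : nat) (a : 'I_n -> nat)
    (T : {fset 'cV[int]_n}) :
  (0 < m)%N ->
  (forall w : 'I_n -> int, (forall i, absz (w i) < N)%N ->
     (m * #|[pred i | w i != 0]| <= N * n)%N ->
     (exists i, w i != 0) -> \sum_i (a i)%:Z * w i != 0) ->
  [set` T] `<=` box N n ->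
  (forall t, t \in T -> \sum_i (a i)%:Z * t i 0 = c%:Z) ->
  contains_cube (Conv R T) j -> (j < m)%N.
Proof.
move=> m0 aw TN Tc [B [z [Binj cubeT]]].
(* Integrality of the points of [T] gives the closed bound [N - 1], whence the strict inequality in
   [row_bound]. *)
pose P : set 'cV[R]_n := [set y | \sum_i (a i)%:R * y i 0 = c%:R /\
  forall i, 0 <= y i 0 <= N%:R - 1].
have convP : @convex_set R 'cV[R]_n P.
  apply: convex_setI => x y t /andP[t0 t1] [xc xN] [yc yN]; split.
    have -> : c%:R = t * c%:R + (1 - t) * c%:R :> R by ring.
    rewrite -{1}xc -yc !mulr_sumr -big_split /=; apply: eq_bigr => i _.
    by rewrite !mxE; ring.
  by move=> i; rewrite !mxE; have := xN i; have := yN i; nra.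
have TP : Conv R T `<=` P.
  apply: smallest_sub convP _ => _ [t tT <-]; split.
    have /(congr1 (fun x : int => x%:~R : R)) := Tc _ tT.
    rewrite rmorph_sum /= -[c%:R]/(c%:Z%:~R) => <-; apply: eq_bigr => i _.
    by rewrite !mxE rmorphM.
  move=> i; have /andP[t0 tN] := TN _ tT i; rewrite mxE ler0z t0 lerBrDr.
  by move: tN; rewrite -lezD1 -(ler_int R) intrD.
pose Q (x : 'cV[R]_j) : 'cV[R]_n := map_mx intr B *m x + map_mx intr z.
have PQ (b : 'I_j -> bool) : P (Q (\col_l (b l)%:R)).
  apply: TP; apply: cubeT; exists (\col_l (b l)%:R) => // l; rewrite mxE.
  by case: (b l); rewrite ?lexx ?ler01.
(* Compare the vertex selecting the positive entries of row [i] with the one selecting the negative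
   entries: their [i]-th coordinates differ by the l1-norm of the row. *)
have row_bound i : (\sum_l absz (B i l) < N)%N.
  have [_ /(_ i)/andP[_ Q1]] := PQ (fun l => 0 < B i l).
  have [_ /(_ i)/andP[Q0 _]] := PQ (fun l => B i l < 0).
  rewrite -(ler_nat R) -natr1; move: (lerB Q1 Q0).
  rewrite subr0 lerBrDr; apply: le_trans; rewrite lerD2r.
  rewrite !mxE opprD addrACA subrr addr0 -sumrB natr_sum.
  apply: ler_sum => l _; rewrite !mxE natr_absz -mulrBr.
  case: (ltrgt0P (B i l)) => _ /=; rewrite ?rmorphN ?sub0r ?subr0 ?subrr ?mulrN ?mulr1
    ?mulr0 ?mulr0z //.
have nz_bound i : (#|[pred l | B i l != 0]| <= N)%N.
  apply: leq_trans (ltnW (row_bound i)); rewrite -sum1_card big_mkcond /=.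
  by apply: leq_sum => l _; rewrite inE; case: eqVneq => // ?; rewrite absz_gt0.
rewrite ltnNge; apply/negP => mj.
(* Double counting: [B] has at most [n * N] nonzero entries, shared among [j >= m] columns. *)
have [l Bl] : exists l, (m * #|[pred i | B i l != 0]| <= N * n)%N.
  apply: contrapT => nol.
  have : (\sum_(l < j) (N * n).+1 <=
      \sum_(l < j) m * #|[pred i | B i l != 0]|)%N.
    apply: leq_sum => l _; rewrite ltnNge; apply/negP => H; apply: nol.
    by exists l.
  rewrite -big_distrr sum_nat_const card_ord /=.
  have -> : (\sum_(l < j) #|[pred i | B i l != 0]| =
             \sum_(i < n) #|[pred l | B i l != 0]|)%N.
    under eq_bigr do rewrite -sum1_card.
    under [RHS]eq_bigr do rewrite -sum1_card.
    by rewrite (exchange_big_dep xpredT).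
  have : (\sum_(i < n) #|[pred l | B i l != 0]| <= n * N)%N.
    rewrite -[n in (n * _)%N]card_ord -sum_nat_const; exact: leq_sum.
  move: (\sum_(i < n) _)%N => s; nia.
have Bl0 : exists i, B i l != 0.
  apply: contrapT => B0; have /colP/(_ l) : delta_mx l 0 = 0 :> 'cV[R]_j.
    apply: Binj; rewrite /= mulmx0 -colE; apply/colP => i; rewrite !mxE.
    apply/eqP; rewrite intr_eq0; apply: contrapT => Bil; apply: B0.
    by exists i; apply/negP.
  by rewrite !mxE !eqxx => /eqP; rewrite oner_eq0.
have Bl_lt i : (absz (B i l) < N)%N.
  by apply: leq_ltn_trans (row_bound i); rewrite (bigD1 l) //= leq_addr.
have /negP := aw (fun i => B i l) Bl_lt Bl Bl0; apply.
have [Q0 _] := PQ (fun=> false); have [Q1 _] := PQ (pred1 l).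
rewrite -(intr_eq0 R) rmorph_sum /=; apply/eqP.
transitivity (c%:R - c%:R : R); last by rewrite subrr.
rewrite -{1}Q1 -{1}Q0 -sumrB; apply: eq_bigr => i _.
rewrite -mulrBr rmorphM /=; congr (_ * _).
rewrite !mxE opprD addrACA subrr addr0 -sumrB (bigD1 l) //=
  !mxE eqxx mulr0 subr0 mulr1.
by rewrite big1 ?addr0 // => k /negPf kl; rewrite !mxE kl subrr.
Qed.

(** * Choice of constants and the dense family *)

Lemma bernoulli_inequality (R : realType) (d : R) (n : nat) :
  0 <= d -> 1 + n%:R * d <= (1 + d) ^+ n.
Proof.
move=> d0; elim: n => [|n IHn]; first by rewrite mul0r addr0 expr0.
rewrite exprS; apply: le_trans (_ : (1 + d) * (1 + n%:R * d) <= _).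
  have : 0 <= n%:R * d * d by rewrite !mulr_ge0 // ler0n.
  by rewrite -natr1; lra.
by rewrite ler_wpM2l // addr_ge0.
Qed.

Lemma exists_leXn (R : realType) (c x : R) :
  1 < c -> exists2 m, (0 < m)%N & x <= c ^+ m.
Proof.
move=> c1; pose m := (Num.truncn (x / (c - 1))).+1; exists m => //.
have c1' : 0 < c - 1 by rewrite subr_gt0.
apply: le_trans (_ : 1 + m%:R * (c - 1) <= _); last first.
  by have := bernoulli_inequality R (c - 1) m (ltW c1'); rewrite subrKC.
have := Num.Theory.truncnS_gt (x / (c - 1)).
by rewrite -/m ltr_pdivrMr // => ?; lra.
Qed.

(** Of the factor [c ^ (4 * n)], one half bounds the number of sparse vectors, hence the
    coefficients of the functional, and the other half absorbs [n * N + 1]. *)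
Lemma dense_bounded (R : realType) (N : nat) (c : R) :
  (2 <= N)%N -> 1 < c ->
  exists n0 m, forall n, (n0 <= n)%N -> exists T : {fset 'cV[int]_n},
    [/\ [set` T] `<=` box N n, (M R T <= m)%N &
        N%:R ^+ n < (#|` T|)%:R * c ^+ (4 * n)].
Proof.
move=> N2 c1; have c0 : 0 < c by apply: lt_trans c1.
have N0 : (0 < N)%N by apply: ltnW.
have d0 : 0 < c - 1 by rewrite subr_gt0.
(* [t], and then [m], are chosen to meet the hypotheses of [card_sparse] for an alphabet of size
   [2 * N]; neither depends on [n]. *)
have [t t0 tc] : exists2 t, (0 < t)%N & (t + (2 * N).-1)%:R <= c * t%:R.
  pose t := (Num.truncn ((2 * N)%:R / (c - 1))).+1; exists t => //.
  have := Num.Theory.truncnS_gt ((2 * N)%:R / (c - 1)).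
  rewrite -/t ltr_pdivrMr // => tN.
  have : ((2 * N).-1)%:R <= (2 * N)%:R :> R by rewrite ler_nat leq_pred.
  by rewrite natrD; lra.
have [m m0 tm] := exists_leXn R c (t%:R ^+ N) c1.
(* From [n0] on, [N < n * (c - 1) ^ 2], so the square of the Bernoulli bound for [c ^ n] exceeds
   [n * N + 1]. *)
pose n0 := (Num.truncn (N%:R / (c - 1) ^+ 2)).+1.
have n0c n : (n0 <= n)%N -> (n * N).+1%:R < c ^+ (2 * n).
  move=> n0n; have n0' : (0 < n)%N by apply: leq_trans n0n.
  apply: lt_le_trans (_ : (1 + n%:R * (c - 1)) ^+ 2 <= _); last first.
    have d1 : 0 <= 1 + n%:R * (c - 1).
      by rewrite addr_ge0 // mulr_ge0 ?ler0n // ltW.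
    rewrite mulnC exprM lerXn2r ?nnegrE ?exprn_ge0 ?(ltW c0) //.
    by have := bernoulli_inequality R (c - 1) n (ltW d0); rewrite subrKC.
  have := Num.Theory.truncnS_gt (N%:R / (c - 1) ^+ 2).
  rewrite ltr_pdivrMr ?exprn_gt0 // -/n0 => Nn0.
  have n0n' : n0%:R <= n%:R :> R by rewrite ler_nat.
  have np : 0 < n%:R :> R by rewrite ltr0n.
  have : n%:R * N%:R < n%:R * (n%:R * (c - 1) ^+ 2).
    rewrite ltr_pM2l //; apply: lt_le_trans Nn0 _.
    by rewrite ler_wpM2r // exprn_ge0 // ltW.
  rewrite -natr1 natrM; have : 0 < n%:R * (c - 1) by rewrite mulr_gt0.
  by move: (n%:R) (c - 1) => x y; rewrite sqrrD; lra.
exists n0, m => n n0n.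
have NJ : (N < 2 * N)%N by lia.
(* [i : 'I_(2 * N)] stands for the integer [i - N]. *)
pose j0 := Ordinal NJ.
pose I := {f : {ffun 'I_n -> 'I_(2 * N)} | sparse j0 m N f}.
pose v (k : I) i : int := (val k i : nat)%:Z - N%:Z.
have [a [aI av]] := generic_functional I n v.
have cardI : (#|{: I}|)%:R <= c ^+ (2 * n).
  rewrite card_sig; apply: (card_sparse R _ j0 n m N t) => //; first exact: ltW.
  by rewrite card_ord.
have [b cardS] := large_fibre N n _ a N0 aI; move: cardS.
set S := finset.finset _ => cardS.
exists [fset grid s | s in S]%fset; split.
- by move=> _ /= /imfsetP[s _ ->]; exact: grid_box.
- apply/bigmax_leqP => j /asboolP cube; apply: ltnW.
  apply: (cube_dim_bound R N n m j b a _ m0 _ _ _ cube).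
  + move=> w wN wm w0.
    have wJ i : (absz (w i + N%:Z)%R < 2 * N)%N by have := wN i; lia.
    pose f := [ffun i => Ordinal (wJ i)].
    have wf i : w i = (f i : nat)%:Z - N%:Z.
      by rewrite ffunE /=; have := wN i; lia.
    have fs : sparse j0 m N f.
      rewrite /sparse; apply: leq_trans wm; rewrite leq_mul2l; apply/orP; right.
      apply/subset_leq_card/fintype.subsetP => i; rewrite !inE; apply: contra.
      by rewrite wf subr_eq0 => /eqP[fi]; apply/eqP/val_inj.
    have := av (exist _ f fs); rewrite /v /= => H.
    under eq_bigr do rewrite wf; apply: H.
    by have [i wi] := w0; exists i; rewrite -wf.
  + by move=> _ /= /imfsetP[s _ ->]; exact: grid_box.
  + move=> _ /imfsetP[s /= + ->]; rewrite inE => /eqP <-.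
    rewrite (big_morph Posz PoszD (erefl _)); apply: eq_bigr => i _.
    by rewrite mxE PoszM.
rewrite card_imfset //=; last exact: grid_inj.
rewrite -cardE; have S0 : (0 < #|S|)%N.
  by move: cardS; case: #|S| => //; rewrite mul0n leqNgt expn_gt0 N0.
rewrite -natrX; apply: le_lt_trans (_ : (#|S| * (n * N * #|{: I}|).+1)%:R < _).
  by rewrite ler_nat.
rewrite natrM ltr_pM2l ?ltr0n //.
apply: le_lt_trans (_ : (n * N).+1%:R * c ^+ (2 * n) < _).
  rewrite -!natr1 natrM mulrDl mul1r lerD ?ler_wpM2l ?ler0n //.
  by rewrite exprn_ege1 // ltW.
have -> : (4 * n = 2 * n + 2 * n)%N by lia.
by rewrite exprD ltr_pM2r ?exprn_gt0 // n0c.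
Qed.

Lemma dense_family (R : realType) (N : nat) (eps : R) :
  (2 <= N)%N -> 0 < eps -> exists S : forall n : nat, {fset 'cV[int]_n},
       (forall n, [set` S n] `<=` box N n) /\
       (exists K : nat, forall n, (M R (S n) <= K)%N) /\
       (forall n, (0 < n)%N ->
          ((1 - eps)%:E < log_card R N (S n) / n%:R%:E)%E).
Proof.
move=> N2 e0; have N0 : (0 < N)%N by apply: ltnW.
have lnN := ln_nat_gt0 R N N2.
(* Chosen so that [c ^ (4 * n)] equals [N] to the power [eps * n]. *)
pose c := expR (eps * ln N%:R / 4) : R.
have c1 : 1 < c by rewrite expR_gt1 divr_gt0 // mulr_gt0.
have [n0 [m dense]] := dense_bounded R N c N2 c1.
have fam n : exists T : {fset 'cV[int]_n},
    [/\ [set` T] `<=` box N n, (M R T <= maxn n0 m)%N &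
        (0 < n)%N -> N%:R ^+ n < (#|` T|)%:R * c ^+ (4 * n)].
  have [n0n|nn0] := leqP n0 n.
    have [T [TN TM Tc]] := dense n n0n; exists T; split => //.
    by rewrite leq_max TM orbT.
  (* For [n < n0] the whole box will do: cubes in it have dimension at most [n], and
     [c ^ (4 * n) > 1] makes the inequality strict once [n > 0]. *)
  exists [fset grid s | s in [set: 'cV['I_N]_n]%SET]%fset; split.
  - by move=> _ /= /imfsetP[s _ ->]; exact: grid_box.
  - apply/bigmax_leqP => j _; rewrite leq_max; apply/orP; left.
    by rewrite -ltnS (leq_trans (ltn_ord j)) // ltnS ltnW.
  move=> n1; rewrite card_imfset //=; last exact: grid_inj.
  rewrite -cardE cardsT card_mx card_ord muln1 natrX.
  rewrite ltr_pMr ?exprn_gt0 ?ltr0n //.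
  by rewrite exprn_egt1 // muln_eq0 /= -lt0n.
pose S n := sval (cid (fam n)).
have SP n := svalP (cid (fam n)).
exists S; split; first by move=> n; have [] := SP n.
split; first by exists (maxn n0 m) => n; have [] := SP n.
move=> n n1; have [_ _ /(_ n1) Sc] := SP n; rewrite -/(S n) in Sc.
have S0 : (0 < #|` S n|)%N.
  rewrite lt0n; apply: contraTneq Sc => ->.
  by rewrite mul0r -leNgt exprn_ge0 ?ler0n.
rewrite log_cardE // lte_fin !ltr_pdivlMr ?ltr0n //.
move: Sc; rewrite -ltr_ln ?posrE ?mulr_gt0 ?exprn_gt0 ?expR_gt0 ?ltr0n //.
rewrite lnM ?posrE ?exprn_gt0 ?expR_gt0 ?ltr0n //.
rewrite !lnXn ?expR_gt0 ?ltr0n // expRK.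
rewrite -[ln _ *+ n]mulr_natr -[_ *+ (4 * n)]mulr_natr natrM.
move: (ln _) (ln _) (n%:R) => x y z; lra.
Qed.

Theorem theorem1p9 (R : realType) (N : nat) (hN : (2 <= N)%N) :
  (forall S : forall n : nat, {fset 'cV[int]_n},
     (forall n, [set` S n] `<=` box N n) ->
     limn_esup (fun n => log_card R N (S n) / n%:R%:E)%E = 1%E ->
     limn_esup (fun n => (M R (S n))%:R%:E : \bar R) = +oo%E) /\
  (forall eps : R, 0 < eps ->
     exists S : forall n : nat, {fset 'cV[int]_n},
       (forall n, [set` S n] `<=` box N n) /\
       (exists K : nat, forall n, (M R (S n) <= K)%N) /\
       (forall n, (0 < n)%N ->
          ((1 - eps)%:E < log_card R N (S n) / n%:R%:E)%E)).
Proof.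
by split=> [S|eps]; [exact: limsup_M_infty | exact: dense_family].
Qed.
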